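(* Let $G=(V,E)$ be a finite simple connected undirected graph on $n$ vertices with cut parameters $\alpha\leq\beta$, and consider the generalized random shortest path metric on $G$. The expected number of iterations of the 2-opt heuristic for TSP until a local optimum is found is $O(n^8\ln^3(n)\,\beta/\alpha)$.
   Context: Generalized random shortest path metric on $G$: each edge $e\in E$ independently receives a weight $w(e)\sim\mathrm{Exp}(1)$, and $d(u,v)$ is the minimum total weight of a $u$–$v$ path in $G$; the TSP instance is the complete graph on $V$ with distances $d$. Cut parameters: for $\varnothing\neq U\subsetneq V$ let $\delta(U)$ be the set of edges with exactly one endpoint in $U$ and $\mu_U=|U|(n-|U|)$; $\alpha=\min_U|\delta(U)|/\mu_U$, $\beta=\max_U|\delta(U)|/\mu_U$. 2-opt heuristic: start with an initial tour on all vertices and repeatedly perform improving 2-exchanges until none exists; a 2-exchange takes tour edges $\{v_1,v_2\},\{v_3,v_4\}$ ($v_1,v_2,v_3,v_4$ visited in this order) and replaces them by $\{v_1,v_3\},\{v_2,v_4\}$, and is improving if the tour length strictly decreases. Each 2-exchange is one iteration. The $O$-constant is absolute. *)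

(* Defs.v *)
From HB Require Import structures.
From mathcomp Require Import all_boot all_order all_algebra.
From mathcomp Require Import all_classical all_reals all_analysis.

Set Implicit Arguments.
Unset Strict Implicit.
Unset Printing Implicit Defensive.

Import Order.TTheory GRing.Theory Num.Theory.

Local Open Scope ring_scope.

(* A finite simple connected graph is a symmetric irreflexive relation [e] on  *)
(* a finite type; its undirected edges are two-element sets of vertices.       *)
Definition simple_connected (V : finType) (e : rel V) : Prop :=
  [/\ symmetric e, irreflexive e & forall u v : V, connect e u v].

Definition edges (V : finType) (e : rel V) : {set {set V}} :=
  [set [set uv.1; uv.2]%SET | uv in [pred uv : V * V | e uv.1 uv.2]]%SET.

Definition edge_boundary (V : finType) (e : rel V) (U : {set V}) : {set {set V}} :=
  [set f in edges e | #|f :&: U| == 1%N]%SET.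

Definition cut_ratio (R : realType) (V : finType) (e : rel V)
    (U : {set V}) : R :=
  #|edge_boundary e U|%:R / (#|U| * (#|V| - #|U|))%N%:R.

(* Every cut ratio lies in [0, 1], so as soon as #|V| > 1 the default values   *)
(* 1 and 0 do not affect the minimum and the maximum.                          *)
Definition cut_alpha (R : realType) (V : finType) (e : rel V) : R :=
  \big[Num.min/1]_(U : {set V} | (U != finset.set0) && (U \proper [set: V])%SET)
    cut_ratio R e U.

Definition cut_beta (R : realType) (V : finType) (e : rel V) : R :=
  \big[Num.max/0]_(U : {set V} | (U != finset.set0) && (U \proper [set: V])%SET)
    cut_ratio R e U.

(* The path is u :: p, in the convention of the library's [path]. *)
Definition path_weight (R : realType) (V : finType) (w : {set V} -> R)
    (u : V) (p : seq V) : R :=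
  \sum_(f <- pairmap (fun x y => [set x; y]%SET) u p) w f.

(* In a connected graph this is the infimum of a finite nonempty set, that is, *)
(* a minimum over the simple u-v paths; the trivial path gives distance 0 when *)
(* u = v.                                                                      *)
Definition sp_dist (R : realType) (V : finType) (e : rel V)
    (w : {set V} -> R) (u v : V) : R :=
  inf [set x | exists p : seq V,
    [/\ path e u p, last u p = v, uniq (u :: p) & x = path_weight w u p]]%classic.

(* A tour is listed from an arbitrary starting vertex; it is closed by the     *)
(* edge from the last vertex to the first one.                                 *)
Definition is_tour (V : finType) (t : seq V) : Prop := perm_eq t (enum V).

Definition tour_length (R : realType) (V : finType) (d : V -> V -> R)
    (t : seq V) : R :=
  \sum_(v <- t) d v (next t v).

(* Removing two tour edges {v1,v2} and {v3,v4}, with v1,v2,v3,v4 visited in    *)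
(* this order, cuts the cyclic sequence into a path A from v2 to v3 and a path *)
(* B from v4 to v1. Adding {v1,v3} and {v2,v4} traverses A backwards. The      *)
(* rotation makes the choice of the two edges independent of the starting      *)
(* vertex of the listing.                                                      *)
Definition two_exchange (V : finType) (t t' : seq V) : Prop :=
  exists (k : nat) (A B : seq V),
    [/\ A != [::], B != [::], rot k t = A ++ B & t' = rev A ++ B].

Definition improving_exchange (R : realType) (V : finType) (d : V -> V -> R)
    (t t' : seq V) : Prop :=
  two_exchange t t' /\ tour_length d t' < tour_length d t.

(* [two_opt_run d t k]: the heuristic started from the tour t can make exactly *)
(* k improving 2-exchanges and then stop in a local optimum. No rule for       *)
(* selecting among several improving 2-exchanges is imposed.                   *)
Inductive two_opt_run (R : realType) (V : finType) (d : V -> V -> R) :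
    seq V -> nat -> Prop :=
| two_opt_stop (t : seq V) :
    (forall t' : seq V, ~ improving_exchange d t t') -> two_opt_run d t 0
| two_opt_step (t t' : seq V) (k : nat) :
    improving_exchange d t t' -> two_opt_run d t' k -> two_opt_run d t k.+1.

Definition mutually_independent (d : measure_display) (T : measurableType d)
    (R : realType) (P : probability T R) (I : finType) (D : {set I})
    (X : I -> {RV P >-> R}) : Prop :=
  forall (J : {set I}) (B : I -> set R),
    J \subset D -> (forall i, measurable (B i)) ->
    P [set x | forall i, i \in J -> B i (X i x)]%classic =
    (\prod_(i in J) P (X i @^-1` B i)%classic)%E.

Definition exp1_distributed (d : measure_display) (T : measurableType d)
    (R : realType) (P : probability T R) (X : {RV P >-> R}) : Prop :=
  forall B : set R, measurable B -> distribution P X B = exponential_prob 1 B.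

(* Main.v *)
Require Import Defs.
From HB Require Import structures.
From mathcomp Require Import all_boot all_order all_algebra.
From mathcomp Require Import ring lra zify.
From mathcomp Require Import all_classical all_reals all_analysis.
From mathcomp Require Import measurable_realfun.

Set Implicit Arguments.
Unset Strict Implicit.
Unset Printing Implicit Defensive.

Import Order.TTheory GRing.Theory Num.Theory.
Local Open Scope ring_scope.

(* Let n = #|V| and let N be the number of iterations. Routing through a fixed *)
(* root along geodesics of the graph bounds every tour by a linear form S in   *)
(* the weights. Geodesics have at most 6 / alpha edges, because all degrees    *)
(* are at least alpha (n - 1) and no vertex is adjacent to more than three     *)
(* vertices of a geodesic; hence E[S] <= 12 n / alpha. If N > k, then some     *)
(* 2-exchange has a gain in ]0, S / (k + 1)]. The gain of a 2-exchange equals  *)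
(* C + sigma * w f for some edge f, some nonzero integer sigma and some C that *)
(* depends only on the other weights; conditionally on these, this happens     *)
(* with probability O(E[S] / (k + 1)). The union bound over the n^4            *)
(* exchanges, the at most beta n^2 edges and the 16 expressions for C and      *)
(* sigma, then the summation over k < n! (tours do not repeat), give           *)
(* O(n^4 * beta n^2 * n / alpha * n ln n).                                     *)

(** * Paths, shortest path distances and gains *)

(** The expectation is the sum over k < n! of the tail probabilities of N. Each tail is at most a
    constant over k + 1 ([iterations_tail_le]), so the sum is harmonic and costs only a factor 1 +
    ln (n!). The deterministic half of the tail bound is [two_opt_run_witness]: a run of more than k
    iterations contains an exchange that gains little compared with S. The form S comes from
    [tour_length_linear_bound], its size from [geodesic_size_le]. In the probabilistic half a single
    edge f is isolated. By [gain_residual] the gain is affine in [w f], with an integer slope of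
    absolute value at least 1, while S is s + c * [w f] with s free of [w f]. Once the other weights
    are fixed, the two inequalities 0 < gain <= S / (k + 1) confine [w f] to a short interval
    ([strip_sub_itv]), whose probability is O((s + c) / (k + 1)). Integrating over the other weights
    ([independent_strip_le]) leaves only the mean of S. [numeric_bound] collects the factors. *)

Definition walk_sum (R : nmodType) (T : Type) (d : T -> T -> R) (x : T)
    (p : seq T) : R := \sum_(z <- pairmap d x p) z.

Lemma walk_sum_nil (R : nmodType) (T : Type) (d : T -> T -> R) (x : T) :
  walk_sum d x [::] = 0.
Proof. exact: big_nil. Qed.

Lemma walk_sum_cons (R : nmodType) (T : Type) (d : T -> T -> R) (x y : T)
    (p : seq T) :
  walk_sum d x (y :: p) = d x y + walk_sum d y p.
Proof. by rewrite /walk_sum/= big_cons. Qed.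

Lemma walk_sum_cat (R : nmodType) (T : Type) (d : T -> T -> R) (x : T)
    (p q : seq T) :
  walk_sum d x (p ++ q) = walk_sum d x p + walk_sum d (last x p) q.
Proof. by rewrite /walk_sum pairmap_cat big_cat. Qed.

Lemma last_rev_belast (T : Type) (x : T) (p : seq T) :
  last (last x p) (rev (belast x p)) = x.
Proof. by case: p => //= y p; rewrite rev_cons last_rcons. Qed.

Lemma walk_sum_rev (R : nmodType) (T : Type) (d : T -> T -> R) (x : T)
    (p : seq T) :
  (forall y z, d y z = d z y) ->
  walk_sum d (last x p) (rev (belast x p)) = walk_sum d x p.
Proof.
move=> dC; elim: p x => //= y p IH x.
rewrite rev_cons -cats1 walk_sum_cat IH last_rev_belast walk_sum_cons.
by rewrite walk_sum_cons walk_sum_nil addr0 addrC dC.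
Qed.

Lemma path_weight_cons (R : realType) (V : finType) (w : {set V} -> R) (u x : V)
    (p : seq V) :
  path_weight w u (x :: p) = w [set u; x]%SET + path_weight w x p.
Proof. by rewrite /path_weight /= big_cons. Qed.

Lemma path_weightE (R : realType) (V : finType) (w : {set V} -> R) (u : V)
    (p : seq V) :
  path_weight w u p = walk_sum (fun x y => w [set x; y]%SET) u p.
Proof.
elim: p u => [|x p IH] u; first by rewrite walk_sum_nil /path_weight big_nil.
by rewrite path_weight_cons IH walk_sum_cons.
Qed.

Definition path_edges (V : finType) (u : V) (p : seq V) : seq {set V} :=
  pairmap (fun x y => [set x; y]%SET) u p.

Lemma path_edges_sub (V : finType) (e : rel V) (u : V) (p : seq V) :
  path e u p -> {subset path_edges u p <= edges e}.
Proof.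
elim: p u => //= x p IH u /andP[ux xp] f; rewrite inE => /orP[/eqP->|]; last exact: IH.
by apply/imsetP; exists (u, x).
Qed.

Lemma path_edges_vertex (V : finType) (u v : V) (p : seq V) (f : {set V}) :
  f \in path_edges u p -> v \in f -> v \in u :: p.
Proof.
elim: p u => //= x p IH u; rewrite inE => /orP[/eqP->|fp vf].
  by rewrite !inE => /orP[->|->]; rewrite ?orbT.
by rewrite in_cons IH ?orbT.
Qed.

Lemma path_edges_uniq (V : finType) (u : V) (p : seq V) :
  uniq (u :: p) -> uniq (path_edges u p).
Proof.
elim: p u => //= x p IH u /andP[uxp xp]; rewrite IH// andbT.
apply/negP => /path_edges_vertex /(_ (set21 _ _)).
by rewrite (negPf uxp).
Qed.

Lemma size_path_edges (V : finType) (u : V) (p : seq V) :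
  size (path_edges u p) = size p.
Proof. exact: size_pairmap. Qed.

(** Turns a sum along a path into a linear form over the edge set: multiplicities are 0 or 1 on a
    simple path, and they become the coefficients of S on the geodesics. *)
Lemma big_seq_count (R : pzSemiRingType) (T : finType) (E : {set T}) (s : seq T)
    (F : T -> R) :
  {subset s <= E} ->
  \sum_(f <- s) F f = \sum_(g in E) (count_mem g s)%:R * F g.
Proof.
elim: s => [_|x s IH sE]; first by rewrite big_nil big1// => g _; rewrite mul0r.
have xE : x \in E by rewrite sE ?mem_head.
rewrite big_cons IH => [|y ys]; last by rewrite sE// in_cons ys orbT.
rewrite [RHS](eq_bigr (fun g => (x == g)%:R * F g + (count_mem g s)%:R * F g)).
  rewrite big_split/=; congr (_ + _).
  rewrite (bigD1 x)//= eqxx mul1r big1 ?addr0// => g /andP[_ /negPf].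
  by rewrite eq_sym => ->; rewrite mul0r.
by move=> g _; rewrite /= natrD mulrDl.
Qed.

(** Bounded sequences make the collection finite; the bound [#|V|] loses nothing, since a simple
    path repeats no vertex. [Q] serves to select the paths that contain, or avoid, a given edge. *)
Definition simple_paths (V : finType) (e : rel V) (u v : V)
    (Q : pred (seq V)) : seq (seq V) :=
  [seq (b : seq V) | b : #|V|.-bseq V in
     [pred b : #|V|.-bseq V | [&& path e u b, last u b == v, uniq (u :: b) & Q b]]].

Lemma mem_simple_paths (V : finType) (e : rel V) (u v : V) (Q : pred (seq V))
    (p : seq V) :
  (p \in simple_paths e u v Q) =
  [&& path e u p, last u p == v, uniq (u :: p) & Q p].
Proof.
apply/idP/idP => [/mapP[b]|pP].
  by rewrite mem_enum => bP ->.
have sp : (size p <= #|V|)%N.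
  have /and4P[_ _ /andP[_ /card_uniqP <-] _] := pP; exact: max_card.
by apply/mapP; exists (Bseq sp); rewrite ?mem_enum.
Qed.

(** The initial value of the minimum is taken at an entry of the list, so it never distorts the
    minimum of a nonempty list; for an empty list the value is [F x0]. *)
Definition seq_min (R : realDomainType) (T : Type) (x0 : T) (F : T -> R)
    (s : seq T) : R := \big[Num.min/F (head x0 s)]_(x <- s) F x.

Lemma seq_min_le (R : realDomainType) (T : eqType) (x0 : T) (F : T -> R)
    (s : seq T) (x : T) :
  x \in s -> seq_min x0 F s <= F x.
Proof.
rewrite /seq_min; elim: s (F (head x0 s)) => //= y s IH m.
rewrite inE big_cons => /orP[/eqP->|xs]; first by rewrite ge_min lexx.
by rewrite ge_min IH ?orbT.
Qed.

Lemma seq_min_attained (R : realDomainType) (T : eqType) (x0 : T) (F : T -> R)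
    (s : seq T) :
  s != [::] -> exists2 x, x \in s & seq_min x0 F s = F x.
Proof.
rewrite /seq_min => s0; rewrite big_seq.
apply: (big_ind (fun m => exists2 x, x \in s & m = F x)) => [|a b|x xs].
- by exists (head x0 s) => //; case: s s0 => //= y s _; exact: mem_head.
- by case=> [x xs ->] [y ys ->]; rewrite /Num.min; case: ifP; [exists x|exists y].
- by exists x.
Qed.

Lemma simple_paths_neq0 (V : finType) (e : rel V) (u v : V) :
  connect e u v -> simple_paths e u v predT != [::].
Proof.
move=> /connectP[p ep ->]; case: (shortenP ep) => q eq uq _.
apply/eqP => h; have := mem_simple_paths e u (last u q) predT q.
by rewrite h in_nil eq eqxx uq.
Qed.

Lemma sp_dist_min (R : realType) (V : finType) (e : rel V) (w : {set V} -> R)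
    (u v : V) :
  connect e u v ->
  sp_dist e w u v =
  seq_min [::] (path_weight w u) (simple_paths e u v predT).
Proof.
move=> /simple_paths_neq0 s0; rewrite /sp_dist; set A := mkset _.
have [p] := seq_min_attained [::] (path_weight w u) s0.
rewrite mem_simple_paths => /and4P[p1 /eqP p2 p3 _] pE.
have lbA : lbound A (path_weight w u p).
  move=> _ [q [q1 q2 q3 ->]]; rewrite -pE; apply: seq_min_le.
  by rewrite mem_simple_paths q1 q2 eqxx q3.
have Ap : A (path_weight w u p) by exists p.
apply/eqP; rewrite pE eq_le; apply/andP; split.
  by apply: ge_inf => //; exists (path_weight w u p).
by apply: lb_le_inf => //; exists (path_weight w u p).
Qed.

Definition drop_edge (R : nmodType) (V : finType) (w : {set V} -> R)
    (f : {set V}) : {set V} -> R := fun g => if g == f then 0 else w g.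

(* The least weight, not counting that of f, of a simple path from u to v that *)
(* contains f (b = true) or avoids f (b = false), and 0 if there is none.      *)
Definition residual_dist (R : realType) (V : finType) (e : rel V)
    (w : {set V} -> R) (f : {set V}) (b : bool) (u v : V) : R :=
  seq_min [::] (path_weight (drop_edge w f) u)
    (simple_paths e u v (fun p => (f \in path_edges u p) == b)).

(** A simple path crosses f at most once, so its weight is affine in [w f] with coefficient 0 or
    1. *)
Lemma path_weight_drop (R : realType) (V : finType) (w : {set V} -> R)
    (f : {set V}) (u : V) (p : seq V) :
  uniq (u :: p) ->
  path_weight w u p = path_weight (drop_edge w f) u p +
                      (f \in path_edges u p)%:R * w f.
Proof.
move=> /path_edges_uniq up; rewrite /path_weight -/(path_edges u p).
have /big_seq_count c : {subset path_edges u p <= finset.setT} by move=> g; rewrite inE.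
rewrite !c (bigD1 f)//= [in RHS](bigD1 f)//= /drop_edge eqxx mulr0 add0r.
rewrite count_uniq_mem// addrC; congr (_ + _).
by apply: eq_bigr => g /andP[_ /negPf->].
Qed.

(** All simple paths that agree with p on containing f have the same coefficient of [w f]; since p
    is shortest overall, it is also shortest in this class after the weight of f is removed. *)
Lemma sp_dist_residual (R : realType) (V : finType) (e : rel V)
    (w : {set V} -> R) (f : {set V}) (u v : V) (p : seq V) :
  connect e u v ->
  p \in simple_paths e u v predT -> sp_dist e w u v = path_weight w u p ->
  let b := f \in path_edges u p in
  sp_dist e w u v = residual_dist e w f b u v + b%:R * w f.
Proof.
move=> uv ps dE b; rewrite /residual_dist.
set s := simple_paths e u v _.
have pss : p \in s.
  by move: ps; rewrite !mem_simple_paths eqxx.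
have s0 : s != [::] by apply/eqP => s0; rewrite s0 in pss.
apply/eqP; rewrite eq_le; apply/andP; split.
  have [q qs ->] := seq_min_attained [::] (path_weight (drop_edge w f) u) s0.
  move: qs; rewrite mem_simple_paths => /and4P[q1 q2 q3 /eqP q4].
  rewrite -q4 -path_weight_drop// sp_dist_min// seq_min_le//.
  by rewrite mem_simple_paths q1 q2 q3.
rewrite dE (path_weight_drop _ f); last first.
  by move: ps; rewrite mem_simple_paths => /and4P[].
by rewrite lerD2r; exact: seq_min_le.
Qed.

Definition gain (R : zmodType) (V : Type) (d : V -> V -> R) (v : V * V * V * V) : R :=
  let: (v1, v2, v3, v4) := v in d v1 v2 + d v3 v4 - d v1 v3 - d v2 v4.

Definition slope (R : pzRingType) (b : bool * bool * bool * bool) : R :=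
  let: (b1, b2, b3, b4) := b in b1%:R + b2%:R - b3%:R - b4%:R.

Definition residual_gain (R : realType) (V : finType) (e : rel V)
    (w : {set V} -> R) (f : {set V}) (b : bool * bool * bool * bool)
    (v : V * V * V * V) : R :=
  let: (b1, b2, b3, b4) := b in let: (v1, v2, v3, v4) := v in
  let r := residual_dist e w f in
  r b1 v1 v2 + r b2 v3 v4 - r b3 v1 v3 - r b4 v2 v4.

Lemma slope_norm_ge1 (R : realDomainType) (b : bool * bool * bool * bool) :
  slope R b != 0 -> 1 <= `|slope R b|.
Proof.
case: b => [[[b1 b2] b3] b4]; rewrite /slope.
(* The slope is an integer, and a nonzero integer has absolute value at least 1. *)
have -> : b1%:R + b2%:R - b3%:R - b4%:R =
    ((b1%:Z + b2%:Z - b3%:Z - b4%:Z)%:~R : R).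
  by rewrite !rmorphB rmorphD.
by rewrite intr_eq0 -intr_norm ler1z -normr_gt0.
Qed.

(* Choose a shortest path for each of the four pairs; then the gain is the sum *)
(* over the edges [f] of [slope * w f], where the booleans tell which of the   *)
(* four paths contain [f], so some edge has a nonzero slope.                   *)
Lemma gain_residual (R : realType) (V : finType) (e : rel V)
    (w : {set V} -> R) (v : V * V * V * V) :
  (forall x y : V, connect e x y) -> gain (sp_dist e w) v != 0 ->
  exists f b, [/\ f \in edges e, slope R b != 0 &
    gain (sp_dist e w) v = residual_gain e w f b v + slope R b * w f].
Proof.
case: v => [[[v1 v2] v3] v4] con.
have ch x y : exists2 p, p \in simple_paths e x y predT &
    sp_dist e w x y = path_weight w x p.
  by rewrite sp_dist_min//; exact/seq_min_attained/simple_paths_neq0.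
have [p1 p1s p1E] := ch v1 v2; have [p2 p2s p2E] := ch v3 v4.
have [p3 p3s p3E] := ch v1 v3; have [p4 p4s p4E] := ch v2 v4.
pose b f := (f \in path_edges v1 p1, f \in path_edges v3 p2,
             f \in path_edges v1 p3, f \in path_edges v2 p4).
have res f : gain (sp_dist e w) (v1, v2, v3, v4) =
    residual_gain e w f (b f) (v1, v2, v3, v4) + slope R (b f) * w f.
  rewrite /gain /residual_gain /slope/=.
  rewrite (sp_dist_residual f (con _ _) p1s)// (sp_dist_residual f (con _ _) p2s)//.
  rewrite (sp_dist_residual f (con _ _) p3s)// (sp_dist_residual f (con _ _) p4s)//=.
  by ring.
have sumE x y p : p \in simple_paths e x y predT ->
    path_weight w x p = \sum_(f in edges e) (f \in path_edges x p)%:R * w f.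
  rewrite mem_simple_paths => /and4P[ep _ up _].
  rewrite /path_weight (big_seq_count _ (path_edges_sub ep)).
  by apply: eq_bigr => f _; rewrite count_uniq_mem// path_edges_uniq.
move=> g0.
have [[f fE fs]|nof] := pselect (exists2 f, f \in edges e & slope R (b f) != 0).
  by exists f, (b f).
case/eqP: g0; rewrite /gain p1E p2E p3E p4E.
rewrite (sumE _ _ _ p1s) (sumE _ _ _ p2s) (sumE _ _ _ p3s) (sumE _ _ _ p4s).
rewrite -big_split/= -!sumrB big1// => f fE.
have /eqP : slope R (b f) = 0 by apply/eqP/negPn/negP => fs; apply: nof; exists f.
by rewrite /slope/= => /eqP s0; rewrite -mulrDl -!mulrBl s0 mul0r.
Qed.

(** * Tours and runs of 2-opt *)

Lemma path_weight_ge0 (R : realType) (V : finType) (e : rel V)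
    (w : {set V} -> R) (u : V) (p : seq V) :
  (forall f, f \in edges e -> 0 <= w f) -> path e u p -> 0 <= path_weight w u p.
Proof.
move=> w0 /path_edges_sub ep; rewrite /path_weight big_seq sumr_ge0// => f fp.
by rewrite w0// ep.
Qed.

Lemma sp_distC (R : realType) (V : finType) (e : rel V) (w : {set V} -> R)
    (u v : V) :
  symmetric e -> sp_dist e w u v = sp_dist e w v u.
Proof.
move=> eC; rewrite /sp_dist; congr inf.
have sub x y : ([set z : R | exists p : seq V, [/\ path e x p, last x p = y,
      uniq (x :: p) & z = path_weight w x p]] `<=`
    [set z | exists p : seq V, [/\ path e y p, last y p = x,
      uniq (y :: p) & z = path_weight w y p]])%classic.
  move=> _ [p [ep <- up ->]]; exists (rev (belast x p)); split.
  - by rewrite rev_path; rewrite (eq_path (e' := e)).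
  - exact: last_rev_belast.
  - by rewrite -rev_rcons -lastI rev_uniq.
  - by rewrite !path_weightE walk_sum_rev// => y' z; rewrite finset.setUC.
by apply/seteqP; split; exact: sub.
Qed.

(** Loop erasure: with nonnegative weights, cutting out a closed part of a walk does not increase
    its weight. *)
Lemma simple_path_le_walk (R : realType) (V : finType) (e : rel V)
    (w : {set V} -> R) (u : V) (p : seq V) :
  (forall f, f \in edges e -> 0 <= w f) -> path e u p ->
  exists2 q, q \in simple_paths e u (last u p) predT &
    path_weight w u q <= path_weight w u p.
Proof.
move=> w0; elim: p u => [|x p IH] u /=.
  by exists [::] => //; rewrite mem_simple_paths /= eqxx.
move=> /andP[ux /IH[q]]; rewrite mem_simple_paths => /and4P[eq lq uq _] qp.
have wux : 0 <= w [set u; x]%SET by rewrite w0//; apply/imsetP; exists (u, x).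
have [uxq|uxq] := boolP (u \in x :: q); last first.
  exists (x :: q); last by rewrite !path_weight_cons lerD2l.
  by rewrite mem_simple_paths /= ux eq lq (negPf uxq) /= in uq *; rewrite uq.
have [uqx|uq'] := eqVneq u x.
  exists q; last first.
    by rewrite [leRHS]path_weight_cons ler_wpDl// uqx.
  by rewrite uqx mem_simple_paths eq lq uq.
(* The path returns to u inside q: only the part after the return is kept. *)
move: uxq; rewrite inE (negPf uq')/= => uiq.
case/splitPr: q / uiq eq lq uq qp => q1 q2 eq lq uq qp.
move: eq; rewrite cat_path /= => /and3P[eq1 eq1u eq2].
move: lq; rewrite last_cat /= => lq.
exists q2.
  rewrite mem_simple_paths eq2 lq /=.
  by move: uq; rewrite -cat_cons cat_uniq => /and3P[_ _ /= ->].
rewrite [leRHS]path_weight_cons.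
apply: ler_wpDl => //; apply: le_trans qp.
rewrite [leRHS]path_weightE walk_sum_cat walk_sum_cons -!path_weightE.
rewrite addrA ler_wpDl// addr_ge0 ?(path_weight_ge0 w0)// w0//.
by apply/imsetP; exists (last x q1, u).
Qed.

Lemma sp_dist_le_walk (R : realType) (V : finType) (e : rel V)
    (w : {set V} -> R) (u : V) (p : seq V) :
  (forall f, f \in edges e -> 0 <= w f) -> path e u p ->
  sp_dist e w u (last u p) <= path_weight w u p.
Proof.
move=> w0 ep; have [q qs qp] := simple_path_le_walk w0 ep.
apply: le_trans qp; rewrite sp_dist_min; last by apply/connectP; exists p.
exact: seq_min_le.
Qed.

Lemma sp_dist_ge0 (R : realType) (V : finType) (e : rel V)
    (w : {set V} -> R) (u v : V) :
  (forall f, f \in edges e -> 0 <= w f) -> connect e u v ->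
  0 <= sp_dist e w u v.
Proof.
move=> w0 uv; rewrite sp_dist_min//.
have [p] := seq_min_attained [::] (path_weight w u) (simple_paths_neq0 uv).
by rewrite mem_simple_paths => /andP[ep _] ->; exact: path_weight_ge0 ep.
Qed.

(** Opens the cycle into a closed walk from x back to x, to which the concatenation and reversal
    rules of [walk_sum] apply. *)
Lemma tour_lengthE (R : realType) (V : finType) (d : V -> V -> R) (x : V)
    (s : seq V) :
  uniq (x :: s) -> tour_length d (x :: s) = walk_sum d x (rcons s x).
Proof.
move=> us; rewrite /tour_length /walk_sum (big_nth x) [RHS](big_nth 0) size_pairmap.
rewrite size_rcons; apply: eq_big_nat => i /andP[_ ilt].
rewrite (nth_pairmap x) ?size_rcons// next_nth mem_nth// index_uniq//.
congr (d _ _).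
  by case: i ilt => //= i ilt; rewrite nth_rcons ltnS in ilt *; rewrite ilt.
rewrite nth_rcons; case: ltngtP => // [h|->]; last by rewrite nth_default.
by move: ilt; rewrite ltnS leqNgt h.
Qed.

Lemma tour_length_rot (R : realType) (V : finType) (d : V -> V -> R) (k : nat)
    (t : seq V) :
  uniq t -> tour_length d (rot k t) = tour_length d t.
Proof.
move=> ut; rewrite /tour_length (perm_big t) ?perm_rot//=.
by apply: eq_bigr => v _; rewrite next_rot.
Qed.

Lemma is_tour_uniq (V : finType) (t : seq V) : is_tour t -> uniq t.
Proof. by move=> /perm_uniq ->; exact: enum_uniq. Qed.

Lemma two_exchange_is_tour (V : finType) (t t' : seq V) :
  two_exchange t t' -> is_tour t -> is_tour t'.
Proof.
move=> [k [A [B [_ _ tE ->]]]]; rewrite /is_tour => tt.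
have ABt : perm_eq (A ++ B) t by rewrite -tE perm_rot.
by apply: perm_trans tt; apply: perm_trans ABt; rewrite perm_cat2r perm_rev.
Qed.

(** By symmetry of d the reversed block A keeps its inner length, so only the two edges between the
    blocks A and B change. *)
Lemma two_exchange_gain (R : realType) (V : finType) (d : V -> V -> R)
    (t t' : seq V) :
  (forall x y, d x y = d y x) -> is_tour t -> two_exchange t t' ->
  exists v, tour_length d t - tour_length d t' = gain d v.
Proof.
move=> dC tt tt'; have ut' := is_tour_uniq (two_exchange_is_tour tt' tt).
case: tt' ut' => k [A [B [A0 B0 tE ->]]] ut'.
case: A A0 => // a A _ in tE ut' *; case: B B0 => // b B _ in tE ut' *.
have ut : uniq (a :: A ++ b :: B).
  by rewrite -cat_cons -tE rot_uniq; exact: is_tour_uniq.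
(* The removed edges run from the end of B to the start of A, and from the end of A to the start of
   B. *)
exists (last b B, a, last a A, b).
rewrite -(tour_length_rot d k) ?(is_tour_uniq tt)// tE cat_cons tour_lengthE//.
have revE : rev (a :: A) = last a A :: rev (belast a A) by rewrite lastI rev_rcons.
rewrite revE cat_cons in ut' *; rewrite tour_lengthE//.
rewrite !rcons_cat !rcons_cons !walk_sum_cat !walk_sum_cons -!cats1 !walk_sum_cat.
rewrite !walk_sum_cons !walk_sum_nil walk_sum_rev// last_rev_belast /gain.
by ring.
Qed.

(** Every vertex occurs once as the source and once as the target of a tour step, hence the factor
    2. In the application h is the weight of a path from the root. *)
Lemma tour_length_le (R : realType) (V : finType) (d : V -> V -> R)
    (h : V -> R) (t : seq V) :
  (forall x y, d x y <= h x + h y) -> is_tour t ->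
  tour_length d t <= \sum_v 2 * h v.
Proof.
move=> dh tt; have -> : \sum_v 2 * h v = \sum_(v <- t) 2 * h v.
  by rewrite (perm_big _ tt) big_enum.
have ut := is_tour_uniq tt.
apply: (@le_trans _ _ (tour_length (fun x y => h x + h y) t)).
  by rewrite /tour_length ler_sum.
case: t ut {tt} => [|x s] us; first by rewrite /tour_length !big_nil.
rewrite {1}/tour_length big_split/=.
rewrite -[X in _ + X]/(tour_length (fun _ y => h y) (x :: s)) tour_lengthE//.
rewrite /walk_sum; have -> y p : pairmap (fun=> [eta h]) y p = map h p.
  by elim: p y => //= z p IH y; rewrite IH.
rewrite big_map; have -> : \sum_(i <- rcons s x) h i = \sum_(i <- x :: s) h i.
  by apply: perm_big; rewrite perm_rcons.
rewrite -big_split/=.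
by rewrite ler_sum// => v _; rewrite -mulr2n mulr_natl.
Qed.

(** Every iteration shortens the tour by more than theta, and the final length is nonnegative. *)
Lemma two_opt_run_lt (R : realType) (V : finType) (d : V -> V -> R) (theta : R)
    (t : seq V) (N : nat) :
  (forall x y, d x y = d y x) -> (forall x y, 0 <= d x y) ->
  (forall v, 0 < gain d v -> theta < gain d v) ->
  is_tour t -> two_opt_run d t N -> (0 < N)%N ->
  N%:R * theta < tour_length d t.
Proof.
move=> dC d0 dtheta tt run; elim: run tt => // {t N} t t' N [tt' lt] run IH tt _.
have [v vE] := two_exchange_gain dC tt tt'.
have g0 : theta < tour_length d t - tour_length d t'.
  by rewrite vE; apply: dtheta; rewrite -vE subr_gt0.
have L0 : 0 <= tour_length d t' by rewrite /tour_length sumr_ge0.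
case: N run IH => [_ _|N _ /(_ (two_exchange_is_tour tt' tt) isT) IH].
  by rewrite mul1r; lra.
by rewrite -[N.+2%:R]natr1 mulrDl mul1r; lra.
Qed.

Lemma two_opt_run_card (R : realType) (V : finType) (d : V -> V -> R)
    (t : seq V) (N : nat) :
  is_tour t -> two_opt_run d t N -> (N <= (#|V|)`!)%N.
Proof.
move=> tt run.
(* The list holds the tours reached after each iteration. That they are all shorter than the
   starting tour is what keeps them distinct in the induction. *)
suff [ts [<- uts tsP]] : exists ts, [/\ size ts = N, uniq ts &
    forall s, s \in ts -> is_tour s /\ tour_length d s < tour_length d t].
  rewrite cardE -(size_permutations (enum_uniq V)).
  apply: uniq_leq_size => // s /tsP[st _].
  by rewrite mem_permutations.
elim: run tt => {t N} [t _ _|t t' N [tt' lt] run IH tt]; first by exists [::].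
have tour' := two_exchange_is_tour tt' tt.
have [ts [<- uts tsP]] := IH tour'; exists (t' :: ts); split => //.
  by rewrite /= uts andbT; apply/negP => /tsP[_]; rewrite ltxx.
move=> s; rewrite inE => /orP[/eqP->//|/tsP[st h]].
by split => //; apply: lt_trans h lt.
Qed.

(** * Cut parameters and geodesics *)

Lemma edgesP (V : finType) (e : rel V) (f : {set V}) :
  reflect (exists u v, e u v /\ f = [set u; v]%SET) (f \in edges e).
Proof.
apply: (iffP imsetP) => [[[u v] uv ->]|[u [v [uv ->]]]]; first by exists u, v.
by exists (u, v).
Qed.

(** With an empty boundary, U would be closed under adjacency and contain everything connected to
    it. *)
Lemma edge_boundary_neq0 (V : finType) (e : rel V) (U : {set V}) :
  simple_connected e -> U != finset.set0 -> (U \proper [set: V])%SET ->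
  (0 < #|edge_boundary e U|)%N.
Proof.
move=> [eC eI econ] /set0Pn[u uU] /properP[_ [v _ vU]].
rewrite lt0n cards_eq0; apply: contra vU => /eqP b0.
suff cl : fingraph.closed e (mem U) by rewrite -(closed_connect cl (econ u v)).
apply: (intro_closed (sym_connect_sym eC)) => x y xy xU.
apply: contraT => yU.
have : [set x; y]%SET \in edge_boundary e U.
  rewrite inE; apply/andP; split; first by apply/edgesP; exists x, y.
  rewrite (_ : _ :&: _ = [set x]%SET) ?cards1//.
  apply/setP => z; rewrite !inE; have [->|_] := eqVneq z x; first exact: xU.
  by have [->|] := eqVneq z y => //=; exact: negbTE.
by rewrite b0 inE.
Qed.

Lemma cut_denom_gt0 (V : finType) (U : {set V}) :
  U != finset.set0 -> (U \proper [set: V])%SET -> (0 < #|U| * (#|V| - #|U|))%N.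
Proof.
move=> U0 /proper_card; rewrite cardsT => UV.
by rewrite muln_gt0 card_gt0 U0 subn_gt0.
Qed.

Lemma cut_alpha_gt0 (R : realType) (V : finType) (e : rel V) :
  simple_connected e -> 0 < cut_alpha R e.
Proof.
move=> sc; rewrite /cut_alpha.
apply: (big_ind (fun x => 0 < x)) => // [x y x0 y0|U /andP[U0 UT]].
  by rewrite lt_min x0.
by rewrite divr_gt0// ltr0n ?edge_boundary_neq0// cut_denom_gt0.
Qed.

Lemma cut_beta_ge0 (R : realType) (V : finType) (e : rel V) :
  0 <= cut_beta R e.
Proof. exact: bigmax_ge_id. Qed.

Lemma vertex_cut (V : finType) (v : V) : (1 < #|V|)%N ->
  ([set v]%SET != finset.set0) && ([set v]%SET \proper [set: V])%SET.
Proof.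
move=> V1; apply/andP; split; first by apply/set0Pn; exists v; rewrite inE.
by rewrite properT; apply: contraL V1 => /eqP vT; rewrite -cardsT -vT cards1.
Qed.

Lemma edge_boundary1_le (V : finType) (e : rel V) (v : V) :
  symmetric e -> (#|edge_boundary e [set v]%SET| <= #|e v|)%N.
Proof.
move=> eC; apply: leq_trans (leq_imset_card (fun z => [set v; z]%SET) (e v)).
apply/subset_leq_card/fintype.subsetP => f; rewrite inE => /andP[/edgesP[x [y [xy ->]]]].
move=> /eqP/eqP/cards1P[z zE].
have : z \in ([set x; y] :&: [set v])%SET by rewrite zE inE.
rewrite !inE => /andP[zxy /eqP zv]; move: zxy; rewrite zv => /orP[/eqP->|/eqP->].
  by apply/imsetP; exists y.
by apply/imsetP; exists x; [rewrite unfold_in/= eC|rewrite finset.setUC].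
Qed.

Lemma cut_alpha_degree (R : realType) (V : finType) (e : rel V) (v : V) :
  symmetric e -> (1 < #|V|)%N ->
  cut_alpha R e * (#|V|.-1)%:R <= (#|e v|)%:R.
Proof.
move=> eC V1.
have : cut_alpha R e <= cut_ratio R e [set v]%SET.
  by apply: bigmin_le_cond; exact: vertex_cut.
rewrite /cut_ratio cards1 mul1n subn1 ler_pdivlMr => [h|]; last first.
  by rewrite ltr0n -ltnS prednK// (ltn_trans _ V1).
by apply: le_trans h _; rewrite ler_nat edge_boundary1_le.
Qed.

(** The cut around a single vertex has at most beta (n - 1) edges, and every edge lies in the cut
    around one of its endpoints. *)
Lemma card_edges_le (R : realType) (V : finType) (e : rel V) :
  simple_connected e -> (1 < #|V|)%N ->
  (#|edges e|)%:R <= cut_beta R e * (#|V|%:R * (#|V|.-1)%:R).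
Proof.
move=> [eC eI _] V1.
have cb v : (#|edge_boundary e [set v]%SET|)%:R <= cut_beta R e * (#|V|.-1)%:R.
  have : cut_ratio R e [set v]%SET <= cut_beta R e.
    by apply: le_bigmax_cond; exact: vertex_cut.
  rewrite /cut_ratio cards1 mul1n subn1 ler_pdivrMr//.
  by rewrite ltr0n -ltnS prednK// (ltn_trans _ V1).
apply: (@le_trans _ _ (\sum_(v : V) (#|edge_boundary e [set v]%SET|)%:R)); last first.
  apply: le_trans (ler_sum _ (fun v _ => cb v)) _.
  by rewrite sumr_const -[leLHS]mulr_natl mulrCA.
rewrite -natr_sum ler_nat -sum1_card.
under [leqRHS]eq_bigr do rewrite -sum1_card big_mkcond /=.
rewrite exchange_big/= big_mkcond leq_sum// => f _; case: ifP => // fE.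
have /edgesP[x [y [xy fxy]]] := fE.
rewrite (bigD1 x)//= ifT// inE fE fxy/=.
rewrite (_ : _ :&: _ = [set x]%SET) ?cards1//.
by apply/setP => z; rewrite !inE; case: eqP; rewrite ?andbF.
Qed.

Definition geodesic (V : finType) (e : rel V) (u : V) (p : seq V) : Prop :=
  path e u p /\
  forall q, path e u q -> last u q = last u p -> (size p <= size q)%N.

Lemma geodesic_exists (V : finType) (e : rel V) (u v : V) :
  connect e u v -> exists2 p, geodesic e u p & last u p = v.
Proof.
move=> /connectP[p0 ep0 vE].
pose Q n := `[< exists p, [/\ path e u p, last u p = v & size p = n] >].
have exQ : exists n, Q n by exists (size p0); apply/asboolP; exists p0.
have [n /asboolP[p [ep lp <-]] min] := ex_minnP exQ.
exists p => //; split => // q eq lq; apply: min; apply/asboolP; exists q.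
by rewrite lq lp.
Qed.

(* A vertex adjacent to the i-th and to the j-th vertex of a geodesic gives a  *)
(* shortcut of length 2, so that [j <= i + 2].                                 *)
Lemma geodesic_count_adj (V : finType) (e : rel V) (u z : V) (p : seq V) :
  symmetric e -> geodesic e u p -> (count (e z) (u :: p) <= 3)%N.
Proof.
move=> eC [ep geo]; pose s := u :: p; rewrite -/s; pose i := find (e z) s.
have [hs|] := boolP (has (e z) s); last by rewrite has_count -leqNgt leqn0 => /eqP->.
have isz : (i <= size p)%N by rewrite -ltnS -/(size s) -has_find.
have key j : (j < size s)%N -> e z (nth u s j) -> (j <= i.+2)%N.
  case: j => // j; rewrite /s /= !ltnS => jsz zj; rewrite leqNgt; apply/negP => ij.
  pose q := take i p ++ z :: drop j p.
  have dE : drop j p = nth u p j :: drop j.+1 p by rewrite (drop_nth u).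
  have lt_ : last u (take i p) = nth u s i.
    by rewrite (last_nth u) size_takel// -[u :: _]/(take i.+1 s) nth_take.
  have eq : path e u q.
    move: ep; rewrite -{1}(cat_take_drop j p) cat_path dE /= => /and3P[ep1 _ ep2].
    rewrite /q cat_path dE /= zj ep2 lt_ [e _ z]eC nth_find// !andbT.
    have ij' : (i <= j)%N by rewrite ltnW// ltnW.
    by move: ep1; rewrite -(cat_take_drop i (take j p)) cat_path take_takel// => /andP[].
  have lq : last u q = last u p.
    by rewrite /q last_cat /= -[in RHS](cat_take_drop j p) last_cat dE.
  have := geo _ eq lq; rewrite /q size_cat /= size_takel// size_drop.
  by move: ij jsz; lia.
have c1 : count (e z) (take i s) = 0%N.
  apply/eqP; rewrite -leqn0 leqNgt -has_count; apply/hasPn => y /(nthP u)[k].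
  rewrite size_take -has_find hs => ki <-; rewrite nth_take//.
  by apply/negbT/before_find.
have c2 : count (e z) (drop (3 + i) s) = 0%N.
  apply/eqP; rewrite -leqn0 leqNgt -has_count; apply/hasPn => y /(nthP u)[k].
  rewrite size_drop nth_drop => kl <-; apply/negP => zk.
  have kl' : (3 + i + k < size s)%N by rewrite -ltn_subRL.
  by have := key _ kl' zk; rewrite leqNgt -addnA leq_addr.
(* Only the positions i, i + 1 and i + 2 can be adjacent to z. *)
have -> : count (e z) s = count (e z) (take 3 (drop i s)).
  transitivity (count (e z) (take i s) + (count (e z) (take 3 (drop i s)) +
      count (e z) (drop 3 (drop i s))))%N; first by rewrite -!count_cat !cat_take_drop.
  by rewrite drop_drop c1 c2 addn0.
by apply: leq_trans (count_size _ _) _; rewrite size_take; case: ltnP.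
Qed.

(* Double counting of the adjacencies with the vertices of the geodesic.       *)
Lemma geodesic_size_le (R : realType) (V : finType) (e : rel V) (u : V)
    (p : seq V) :
  simple_connected e -> (1 < #|V|)%N -> geodesic e u p ->
  (size p)%:R <= 6 / cut_alpha R e.
Proof.
move=> sc V1 geo; have [eC _ _] := sc.
have a0 := cut_alpha_gt0 R sc.
have n0 : (0 < #|V|.-1)%N by rewrite -ltnS prednK// (ltn_trans _ V1).
have : \sum_(y <- u :: p) (cut_alpha R e * (#|V|.-1)%:R) <= (3 * #|V|)%:R.
  apply: (@le_trans _ _ (\sum_(y <- u :: p) (#|e y|)%:R)).
    by apply: ler_sum => y _; exact: cut_alpha_degree.
  rewrite -natr_sum ler_nat.
  under eq_bigr do rewrite -sum1_card big_mkcond /=.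
  rewrite exchange_big /= mulnC -sum_nat_const leq_sum// => z _.
  apply: leq_trans (geodesic_count_adj z eC geo).
  rewrite -sum1_count [leqRHS]big_mkcond leq_sum// => y _.
  by rewrite unfold_in eC.
rewrite big_const_seq count_predT iter_addr_0 => h.
rewrite ler_pdivlMr// -(ler_pM2r (_ : 0 < (#|V|.-1)%:R :> R)) ?ltr0n// -mulrA.
apply: le_trans (le_trans h _).
  by rewrite -[leRHS]mulr_natl ler_wpM2r ?ler_nat//= mulr_ge0// ltW.
(* The constant 6 comes from 3 n <= 6 (n - 1), valid for n >= 2. *)
by rewrite -natrM ler_nat; lia.
Qed.

Local Open Scope classical_set_scope.

(** * Independence and the exponential distribution *)

Lemma measurable_set_le (R : realType) (disp : measure_display)
    (T : measurableType disp) (f g : T -> R) :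
  measurable_fun setT f -> measurable_fun setT g ->
  measurable [set x | f x <= g x].
Proof.
by move=> mf mg; rewrite -[X in measurable X]setTI; exact: measurable_fun_le.
Qed.

Lemma measurable_set_lt (R : realType) (disp : measure_display)
    (T : measurableType disp) (f g : T -> R) :
  measurable_fun setT f -> measurable_fun setT g ->
  measurable [set x | f x < g x].
Proof.
move=> mf mg; rewrite (_ : [set x | _] = ~` [set x | g x <= f x]).
  exact/measurableC/measurable_set_le.
by apply/seteqP; split => x /=; rewrite real_ltNge ?num_real// => /negP.
Qed.

Lemma measurable_nat_gt (disp : measure_display) (T : measurableType disp)
    (N : {mfun T >-> nat}) (k : nat) :
  measurable [set x | (k < N x)%N].
Proof.
have mN : measurable_fun setT (N : T -> nat) by exact: measurable_funPT.
have mB : measurable [set n | (k < n)%N] by [].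
by have := mN measurableT _ mB; rewrite setTI.
Qed.

Lemma measurable_sum_seq (R : realType) (disp : measure_display)
    (T : measurableType disp) (I : eqType) (s : seq I) (h : I -> T -> R) :
  (forall i, i \in s -> measurable_fun setT (h i)) ->
  measurable_fun setT (fun x => \sum_(i <- s) h i x).
Proof.
elim: s => [|i s IH] mh.
  under eq_fun do rewrite big_nil; exact: measurable_cst.
under eq_fun do rewrite big_cons; apply: measurable_funD.
  by apply: mh; exact: mem_head.
by apply: IH => j js; apply: mh; rewrite inE js orbT.
Qed.

(** Both sides are finite measures in A that agree on a pi-system containing the whole space, hence
    on the sigma-algebra that it generates. *)
Lemma g_sigma_independent (R : realType) (disp : measure_display)
    (Omega : measurableType disp) (P : probability Omega R)
    (G : set (set Omega)) (B : set Omega) :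
  G `<=` measurable -> setI_closed G -> G setT -> measurable B ->
  (forall A, G A -> P (A `&` B) = (P A * P B)%E) ->
  forall A, <<s G >> A -> P (A `&` B) = (P A * P B)%E.
Proof.
move=> GM GI GT mB indep A sA.
have PBfin : P B \is a fin_num by rewrite fin_num_measure.
have PB0 : (0 <= fine (P B))%R by rewrite fine_ge0.
pose r := NngNum PB0.
have cover : \bigcup_(k : nat) (@setT Omega) = setT.
  by apply: bigcup_const; exists 0%N.
have scaleE C : mscale r P C = (P C * P B)%E.
  by rewrite /mscale/= fineK// muleC.
rewrite -scaleE -[LHS]/(mrestr P mB A).
apply: (g_sigma_algebra_measure_unique G GM (fun=> setT) (fun=> GT) cover) => //.
- by move=> C GC; rewrite [RHS]scaleE -indep.
- by move=> _; rewrite /= /mrestr setTI (le_lt_trans (probability_le1 _ _)) ?ltry.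
Qed.

(** Conditioning on the sigma-algebra generated by G: the joint law of X and the identity, read as a
    map into that sigma-algebra, is a product measure, so the probability of E is the integral of
    the law of X over its sections. *)
Lemma independent_pair_prob (R : realType) (disp : measure_display)
    (Omega : measurableType disp) (P : probability Omega R)
    (G : set (set Omega)) (X : {RV P >-> R}) :
  G `<=` measurable -> setI_closed G -> G setT ->
  (forall A B, G A -> measurable B ->
     P (A `&` X @^-1` B) = (P A * P (X @^-1` B))%E) ->
  forall E : set (g_sigma_algebraType G * R), measurable E ->
  P [set omega | E (omega, X omega)] =
    (\int[P]_omega distribution P X (xsection E omega))%E.
Proof.
move=> GM GI GT indep E mE.
have sGM : <<s G >> `<=` @measurable _ Omega.
  exact: (smallest_sub (@sigma_algebra_measurable _ Omega) GM).
pose T1 := g_sigma_algebraType G.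
pose i1 : Omega -> T1 := fun x => x.
have mi1 : measurable_fun setT i1.
  by move=> _ A mA; rewrite setTI; exact: sGM.
pose i1' : {mfun Omega >-> T1} :=
  HB.pack i1 (@isMeasurableFun.Build _ _ _ _ i1 mi1).
pose j : Omega -> T1 * R := fun x => (x, X x).
have mj : measurable_fun setT j.
  by apply: measurable_fun_pair => //; exact: measurable_funPT.
pose j' : {mfun Omega >-> (T1 * R)%type} :=
  HB.pack j
    (@isMeasurableFun.Build _ _ _ _ j mj).
transitivity (distribution P j' E) => //.
rewrite -(@product_measure_unique _ _ T1 R R (distribution P i1')
  (distribution P X) (distribution P j') _ E mE); last first.
  move=> A B mA mB.
  transitivity (P (A `&` X @^-1` B)) => //.
  apply: (g_sigma_independent (G := G)) => //.
    by rewrite -[X in measurable X]setTI; exact: measurable_funP.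
  by move=> A' GA'; exact: indep.
rewrite /product_measure1.
rewrite (@ge0_integral_distribution _ _ Omega T1 R P i1')//.
exact: measurable_fun_xsection.
Qed.

(** On the interval the density is at most its value exp (- a) at the left end. *)
Lemma exponential_prob_itv_le (R : realType) (a l : R) : 0 <= a -> 0 <= l ->
  (exponential_prob 1 `[a, (a + l)%R] <= (expR (- a) * l)%R%:E)%E.
Proof.
move=> a0 l0; rewrite /exponential_prob.
apply: (@le_trans _ _ (\int[lebesgue_measure]_(x in `[a, (a + l)%R])
          cst (expR (- a)%R)%:E x)%E).
  apply: ge0_le_integral => //=.
  - by move=> x _; rewrite lee_fin exponential_pdf_ge0.
  - apply/measurable_EFinP; apply: measurable_funTS.
    exact: measurable_exponential_pdf.
  - move=> x /=; rewrite in_itv/= => /andP[ax _].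
    by rewrite lee_fin exponential_pdfE ?(le_trans a0)// mul1r mulN1r ler_expR lerN2.
rewrite integral_cst//= lebesgue_measure_itv/= lte_fin.
case: ifPn => _; last by rewrite mule0 lee_fin mulr_ge0// expR_ge0.
by rewrite -EFinB -EFinM lee_fin addrAC subrr add0r.
Qed.

Lemma strip_sub_itv (R : realFieldType) (C sigma s c k : R) :
  0 <= s -> 0 <= c -> 0 < k -> 2 * c <= k -> 1 <= `|sigma| ->
  exists2 a, 0 <= a & forall t, 0 <= t -> 0 < C + sigma * t ->
    k * (C + sigma * t) <= s + c * t -> a <= t <= a + 2 * (s + c * a) / k.
Proof.
move=> s0 c0 k0 ck sigma1.
(* From k (t - a) <= s + c t follows (k - c) (t - a) <= s + c a, and k - c >= k / 2; this is the
   origin of the factor 2. *)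
suff [a a0 aP] : exists2 a, 0 <= a & forall t, 0 <= t -> 0 < C + sigma * t ->
    k * (C + sigma * t) <= s + c * t ->
    a <= t /\ (k * (t - a) <= s + c * t).
  exists a => // t t0 h1 h2; have [-> /= h3] := aP t t0 h1 h2.
  rewrite -lerBlDl ler_pdivlMr// mulrC.
  have : 0 <= (k - 2 * c) * (t - a).
    by rewrite mulr_ge0 ?subr_ge0//; have [] := aP t t0 h1 h2.
  lra.
have [sigma0|sigma0] := leP 0 sigma.
  rewrite ger0_norm// in sigma1.
  have sigma_gt0 : 0 < sigma by lra.
  (* For a positive slope, a is the zero of C + sigma t, cut off at 0; beyond it the gain grows at
     least like t - a. *)
  exists (Num.max 0 (- C / sigma)) => [|t t0 h1 h2]; first by rewrite le_max lexx.
  have hC : - C <= sigma * t by lra.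
  have ha : Num.max 0 (- C / sigma) <= t.
    by rewrite ge_max t0 ler_pdivrMr// mulrC.
  split => //; apply: le_trans h2; rewrite ler_pM2l//.
  set a := Num.max _ _ in ha *.
  have aC : - C <= sigma * a.
    by rewrite mulrC -ler_pdivrMr// le_max lexx orbT.
  have : 0 <= (sigma - 1) * (t - a) by rewrite mulr_ge0 ?subr_ge0.
  lra.
rewrite ltr0_norm// in sigma1.
have d0 : 0 < c - k * sigma.
  by have := mulr_gt0 k0 (_ : 0 < - sigma); rewrite oppr_gt0 mulrN => /(_ sigma0); lra.
(* For a negative slope the upper constraint gives the left end: a is where k (C + sigma t) meets s
   + c t, cut off at 0. Beyond it the gain falls at rate at least 1 and must stay positive. *)
pose a := Num.max 0 ((k * C - s) / (c - k * sigma)).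
exists a => [|t t0 h1 h2]; first by rewrite le_max lexx.
have ha : a <= t.
  by rewrite ge_max t0 ler_pdivrMr//; lra.
split => //.
have aC : k * C - s <= a * (c - k * sigma).
  by rewrite -ler_pdivrMr// le_max lexx orbT.
have h3 : 0 <= k * (- sigma - 1) * (t - a).
  by rewrite !mulr_ge0 ?subr_ge0// ltW.
have h4 : 0 <= k * (C + sigma * t) by rewrite mulr_ge0 ?ltW.
have h5 : 0 <= c * (t - a) by rewrite mulr_ge0 ?subr_ge0.
lra.
Qed.

(* For [2 c <= k] the strip lies in [a, a + 2 (s + c a) / k] for some a >= 0,  *)
(* and exp (- a) * a <= 1; for [k < 2 c] the bound exceeds 1.                  *)
Lemma exp1_distributed_strip_le (R : realType) (disp : measure_display)
    (Omega : measurableType disp) (P : probability Omega R)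
    (X : {RV P >-> R}) (C sigma s c k : R) :
  exp1_distributed X -> 0 <= s -> 0 <= c -> 0 < k -> 1 <= `|sigma| ->
  (distribution P X [set t | [/\ (0 <= t)%R, (0 < C + sigma * t)%R &
    (k * (C + sigma * t) <= s + c * t)%R]] <= (2 * (s + c) / k)%R%:E)%E.
Proof.
move=> X1 s0 c0 k0 sigma1; set A := [set t | _].
have mA : measurable A.
  have -> : A = [set t | 0 <= t] `&` [set t | 0 < C + sigma * t] `&`
                [set t | k * (C + sigma * t) <= s + c * t].
    by apply/seteqP; split => t /=; [case|case=> -[]].
  have maff (x y : R) : measurable_fun setT (fun t : R => x + y * t).
    by apply: measurable_funD => //; apply: measurable_funM.
  apply: measurableI; first apply: measurableI.
  - exact: (measurable_set_le (f := cst 0)).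
  - exact: (measurable_set_lt (f := cst 0)).
  - by apply: measurable_set_le; [exact: measurable_funM|].
have [ck|ck] := ltP k (2 * c).
  apply: le_trans (probability_le1 _ mA) _; rewrite lee_fin ler_pdivlMr//; lra.
have [a a0 aP] := @strip_sub_itv R C sigma s c k s0 c0 k0 ck sigma1.
have l0 : 0 <= 2 * (s + c * a) / k.
  by rewrite mulr_ge0 ?invr_ge0 ?(ltW k0)// mulr_ge0// addr_ge0// mulr_ge0.
apply: (@le_trans _ _ (distribution P X `[a, (a + 2 * (s + c * a) / k)%R])).
  apply: le_measure; rewrite ?inE//.
  by move=> t [t0 h1 h2] /=; rewrite in_itv/= aP.
rewrite X1//; apply: le_trans (exponential_prob_itv_le a0 l0) _.
rewrite lee_fin mulrA ler_pM2r ?invr_gt0//.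
have e1 : expR (- a) <= 1 by rewrite -expR0 ler_expR oppr_le0.
have ea : expR (- a) * a <= 1.
  rewrite expRN mulrC ler_pdivrMr ?expR_gt0// mul1r.
  by apply: le_trans (expR_ge1Dx a); rewrite lerDr.
have : 0 <= s * (1 - expR (- a)) by rewrite mulr_ge0 ?subr_ge0.
have : 0 <= c * (1 - expR (- a) * a) by rewrite mulr_ge0 ?subr_ge0.
lra.
Qed.

(** Weights are nonnegative only almost surely; this discards the event on which the deterministic
    part does not apply. *)
Lemma exp1_distributed_lt0 (R : realType) (disp : measure_display)
    (Omega : measurableType disp) (P : probability Omega R)
    (X : {RV P >-> R}) :
  exp1_distributed X -> P [set omega | (X omega < 0)%R] = 0%E.
Proof.
move=> /(_ `]-oo, 0[ (measurable_itv _)).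
rewrite /distribution /pushforward /exponential_prob integral0_eq.
  by move=> h; rewrite -[RHS]h; congr (P _); apply/seteqP; split => x /=;
     rewrite in_itv.
by move=> x /=; rewrite in_itv/= => x0; rewrite lt0_exponential_pdf.
Qed.

(** The mean is the integral of the tail P(|X| > r), and this tail is at most exp (- r), which is
    the exponential density itself. *)
Lemma exp1_distributed_abs_mean (R : realType) (disp : measure_display)
    (Omega : measurableType disp) (P : probability Omega R)
    (X : {RV P >-> R}) :
  exp1_distributed X -> (\int[P]_omega `|X omega|%:E <= 1)%E.
Proof.
move=> X1.
pose aX : Omega -> R := fun omega => `|X omega|.
have maX : measurable_fun setT aX.
  by apply: measurableT_comp => //; exact: measurable_funPT.
pose aX' : {RV P >-> R} := HB.pack aX (@isMeasurableFun.Build _ _ _ _ aX maX).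
have := @ge0_expectation_ccdf _ Omega R P aX' (fun x => normr_ge0 _).
rewrite unlock => ->.
rewrite -(integral_exponential_pdf ltr01).
apply: (@le_trans _ _ (\int[lebesgue_measure]_(r in `[0%R, +oo[)
   (exponential_pdf 1 r)%:E)%E); last first.
  apply: ge0_subset_integral => //.
  - by apply/measurable_EFinP; exact: measurable_exponential_pdf.
  - by move=> x _; rewrite lee_fin exponential_pdf_ge0.
apply: ge0_le_integral => //.
- by apply: measurable_funTS; exact: ccdf_measurable.
- apply: measurable_funTS; apply/measurable_EFinP.
  exact: measurable_exponential_pdf.
move=> r /=; rewrite in_itv/= andbT => r_ge0.
have [->|r_neq0] := eqVneq r 0.
  rewrite exponential_pdfE// mulr0 expR0 mulr1; exact: probability_le1.
have r0 : 0 < r by rewrite lt_neqAle eq_sym r_neq0.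
rewrite exponential_pdfE// mul1r.
rewrite (_ : ccdf aX' r = P (X @^-1` [set t | (r < `|t|)%R])); last first.
  by rewrite /ccdf/= /distribution/pushforward; congr (P _);
     apply/seteqP; split=> x /=; rewrite in_itv/= andbT.
have mB : measurable [set t : R | r < `|t|].
  rewrite (_ : [set t | _] = ~` [set t : R | `|t| <= r]); last first.
    by apply/seteqP; split=> t /=; rewrite real_ltNge ?num_real// => /negP.
  apply: measurableC; rewrite -[X in measurable X]setTI.
  by apply: measurable_fun_le => //; exact: measurable_normr.
apply: (@le_trans _ _ (distribution P X (~` `[0, r]))).
  apply: (@le_measure _ _ _ (distribution P X) [set t : R | r < `|t|]);
    rewrite ?inE//; first exact: measurableC.
  move=> t /= rt; rewrite in_itv/= => /andP[t0 tr].
  by move: rt; rewrite ger0_norm// ltNge tr.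
have mI : measurable (`[0, r]%classic : set R) by exact: measurable_itv.
have -> : distribution P X (~` `[0%R, r]) =
    (1 - distribution P X (`[0%R, r]%classic : set R))%E.
  exact: probability_setC.
have -> := X1 _ mI; rewrite exponential_prob_itv0c//.
by rewrite -EFinB lee_fin mulN1r; lra.
Qed.

Lemma measurable_seq_min (R : realType) (disp : measure_display)
    (T : measurableType disp) (I : eqType) (x0 : I) (F : I -> T -> R)
    (s : seq I) :
  measurable_fun setT (F x0) ->
  (forall i, i \in s -> measurable_fun setT (F i)) ->
  measurable_fun setT (fun x => seq_min x0 (F^~ x) s).
Proof.
move=> m0 ms; rewrite /seq_min.
have : measurable_fun setT (F (head x0 s)).
  by case: s ms => // i s; apply; exact: mem_head.
elim: s (head x0 s) ms => [|i s IH] j ms mj; first by under eq_fun do rewrite big_nil.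
under eq_fun do rewrite big_cons; apply: measurable_minr; first exact/ms/mem_head.
by apply: IH => // k ks; apply: ms; rewrite inE ks orbT.
Qed.

Lemma measurable_path_weight (R : realType) (disp : measure_display)
    (T : measurableType disp) (V : finType) (e : rel V)
    (w : {set V} -> T -> R) (u : V) (p : seq V) :
  path e u p -> (forall f, f \in edges e -> measurable_fun setT (w f)) ->
  measurable_fun setT (fun x => path_weight (w^~ x) u p).
Proof.
move=> + mw; elim: p u => [|v p IH] u /=.
  move=> _; under eq_fun do rewrite path_weightE walk_sum_nil.
  exact: measurable_cst.
move=> /andP[uv vp].
under eq_fun do rewrite path_weight_cons.
by apply: measurable_funD; [apply/mw/edgesP; exists u, v|exact: IH].
Qed.

(** Only the weights of edges other than f are assumed measurable. Over the sigma-algebra that they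
    generate, this says that the residual gain is a function of them. *)
Lemma measurable_residual_gain (R : realType) (disp : measure_display)
    (T : measurableType disp) (V : finType) (e : rel V)
    (w : {set V} -> T -> R) (f : {set V}) (b : bool * bool * bool * bool)
    (v : V * V * V * V) :
  (forall g, g \in edges e -> g != f -> measurable_fun setT (w g)) ->
  measurable_fun setT (fun x => residual_gain e (w^~ x) f b v).
Proof.
move=> mw; case: b => [[[b1 b2] b3] b4]; case: v => [[[v1 v2] v3] v4] /=.
have mr c x y : measurable_fun setT (fun t => residual_dist e (w^~ t) f c x y).
  apply: (@measurable_seq_min _ _ T _ [::]
    (fun p t => path_weight (drop_edge (w^~ t) f) x p)).
    under eq_fun do rewrite path_weightE walk_sum_nil.
    exact: measurable_cst.
  move=> p; rewrite mem_simple_paths => /and4P[xp _ _ _].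
  apply: (measurable_path_weight (w := fun g t => drop_edge (w^~ t) f g) xp).
  move=> g gE; rewrite /drop_edge; case: eqVneq => // gf; exact: mw.
by apply: measurable_funB => //; apply: measurable_funB => //; apply: measurable_funD.
Qed.

(** A pi-system that generates the sigma-algebra of the variables [X i] with i in D. *)
Definition cylinders (R : realType) (disp : measure_display)
    (T : measurableType disp) (I : finType) (X : I -> T -> R) (D : {set I}) :
    set (set T) :=
  [set A | exists2 B : I -> set R, (forall i, measurable (B i)) &
     A = [set x | forall i, i \in D -> B i (X i x)]].

Lemma cylinders_setI (R : realType) (disp : measure_display)
    (T : measurableType disp) (I : finType) (X : I -> T -> R) (D : {set I}) :
  setI_closed (cylinders X D).
Proof.
move=> _ _ [B mB ->] [C mC ->]; exists (fun i => B i `&` C i).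
  by move=> i; exact: measurableI.
apply/seteqP; split => x /=; first by move=> [h1 h2] i iD; split; [exact: h1|exact: h2].
by move=> h; split => i iD; have [] := h i iD.
Qed.

Lemma cylinders_setT (R : realType) (disp : measure_display)
    (T : measurableType disp) (I : finType) (X : I -> T -> R) (D : {set I}) :
  cylinders X D setT.
Proof. by exists (fun=> setT) => //; apply/seteqP; split. Qed.

Lemma cylinders_measurable (R : realType) (disp : measure_display)
    (T : measurableType disp) (I : finType) (X : I -> T -> R) (D : {set I}) :
  (forall i, measurable_fun setT (X i)) -> cylinders X D `<=` measurable.
Proof.
move=> mX _ [B mB ->].
rewrite (_ : [set x | _] = \bigcap_(i in [set i | i \in D]) (X i @^-1` B i))//.
apply: fin_bigcap_measurable => [|i _]; first exact: finite_finset.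
by rewrite -[X in measurable X]setTI; exact: mX.
Qed.

Lemma cylinders_measurable_fun (R : realType) (disp : measure_display)
    (T : measurableType disp) (I : finType) (X : I -> T -> R) (D : {set I})
    (i : I) :
  i \in D ->
  measurable_fun setT (X i : g_sigma_algebraType (cylinders X D) -> R).
Proof.
move=> iD _ B mB; rewrite setTI; apply: sub_sigma_algebra.
exists (fun j => if j == i then B else setT); first by move=> j; case: ifP.
apply/seteqP; split => x /=; first by move=> h j _; case: eqP => // ->.
by move=> /(_ i iD); rewrite eqxx.
Qed.

(** Compares the product formula for D, with B inserted at i, and the one for D without i. *)
Lemma mutually_independent_cylinder (R : realType) (disp : measure_display)
    (T : measurableType disp) (P : probability T R) (I : finType)
    (D : {set I}) (X : I -> {RV P >-> R}) (i : I) :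
  mutually_independent D X -> i \in D ->
  forall A B, cylinders (fun j => X j : T -> R) (D :\ i)%SET A ->
    measurable B -> P (A `&` X i @^-1` B) = (P A * P (X i @^-1` B))%E.
Proof.
move=> indep iD _ B [C mC ->] mB.
pose C' j := if j == i then B else C j.
have mC' j : measurable (C' j) by rewrite /C'; case: ifP.
have E1 := indep D C' (subxx _) mC'.
have E2 := indep (D :\ i)%SET C (subsetDl _ _) mC.
rewrite E2 (_ : _ `&` _ = [set x | forall j, j \in D -> C' j (X j x)]).
  rewrite E1 (big_setD1 i)//= muleC /C' eqxx; congr (_ * _)%E.
  by apply: eq_bigr => j; rewrite !inE => /andP[/negPf->].
apply/seteqP; split => x /=.
  move=> [h1 h2] j jD; rewrite /C'; case: eqVneq => [->//|ji].
  by apply: h1; rewrite !inE ji.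
move=> h; split; last by have := h i iD; rewrite /C' eqxx.
by move=> j; rewrite !inE => /andP[/negPf ji jD]; have := h j jD; rewrite /C' ji.
Qed.

(** C and s are measurable with respect to the variables other than [X i], so they act as constants
    in each section, where [exp1_distributed_strip_le] applies. *)
Lemma independent_strip_le (R : realType) (disp : measure_display)
    (Omega : measurableType disp) (P : probability Omega R) (I : finType)
    (D : {set I}) (X : I -> {RV P >-> R}) (i : I) (C s : Omega -> R)
    (sigma c k : R) :
  let T1 := g_sigma_algebraType (cylinders (fun j => X j : Omega -> R) (D :\ i)%SET) in
  mutually_independent D X -> i \in D -> exp1_distributed (X i) ->
  measurable_fun setT (C : T1 -> R) -> measurable_fun setT (s : T1 -> R) ->
  measurable_fun setT s ->
  (forall omega, 0 <= s omega) -> 0 <= c -> 0 < k -> 1 <= `|sigma| ->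
  (P [set omega | [/\ (0 <= X i omega)%R, (0 < C omega + sigma * X i omega)%R &
      (k * (C omega + sigma * X i omega) <= s omega + c * X i omega)%R]]
   <= \int[P]_omega (2 * (s omega + c) / k)%R%:E)%E.
Proof.
move=> T1 indep iD Xi mC ms ms' s0 c0 k0 sigma1.
pose E := [set z : T1 * R | [/\ 0 <= z.2, 0 < C z.1 + sigma * z.2 &
      k * (C z.1 + sigma * z.2) <= s z.1 + c * z.2]].
have mC1 : measurable_fun setT (fun z : T1 * R => C z.1).
  exact: (measurableT_comp mC measurable_fst).
have ms1 : measurable_fun setT (fun z : T1 * R => s z.1).
  exact: (measurableT_comp ms measurable_fst).
have m2 a : measurable_fun setT (fun z : T1 * R => a * z.2).
  by apply: measurable_funM => //; exact: measurable_snd.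
have mE : measurable E.
  rewrite (_ : E = [set z | 0 <= z.2] `&` [set z | 0 < C z.1 + sigma * z.2] `&`
      [set z | k * (C z.1 + sigma * z.2) <= s z.1 + c * z.2]); last first.
    by apply/seteqP; split => z /=; [case|case=> -[]].
  apply: measurableI; first apply: measurableI.
  - by apply: (measurable_set_le (f := cst 0)) => //; exact: measurable_snd.
  - by apply: (measurable_set_lt (f := cst 0)) => //; exact: measurable_funD.
  - apply: measurable_set_le; last exact: measurable_funD.
    by apply: measurable_funM => //; exact: measurable_funD.
have Xm j : measurable_fun setT (X j : Omega -> R) by exact: measurable_funPT.
have := @independent_pair_prob R disp Omega P _ (X i)
  (@cylinders_measurable _ _ _ _ _ (D :\ i)%SET Xm)
  (@cylinders_setI _ _ _ _ _ _) (@cylinders_setT _ _ _ _ _ _)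
  (mutually_independent_cylinder indep iD) E mE.
move=> EE; rewrite [leLHS]EE.
apply: ge0_le_integral => //=.
- move=> _ B mB; rewrite setTI.
  apply: (smallest_sub (@sigma_algebra_measurable _ Omega)
    (@cylinders_measurable _ _ _ _ _ (D :\ i)%SET Xm)).
  have := @measurable_fun_xsection _ _ T1 R R (distribution P (X i)) E mE.
  by move=> /(_ measurableT B mB); rewrite setTI.
- apply/measurable_EFinP; apply: measurable_funM => //.
  by apply: measurable_funM => //; apply: measurable_funD.
move=> omega _; rewrite (_ : xsection E omega = [set t | [/\ 0 <= t,
    0 < C omega + sigma * t & k * (C omega + sigma * t) <= s omega + c * t]]).
  exact: exp1_distributed_strip_le.
by apply/seteqP; split => t; rewrite /xsection/= inE.
Qed.

Lemma integral_affine_le (R : realType) (disp : measure_display)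
    (Omega : measurableType disp) (P : probability Omega R) (I : finType)
    (D : {set I}) (X : I -> {RV P >-> R}) (a : I -> R) (b c : R) :
  (forall i, i \in D -> exp1_distributed (X i)) ->
  (forall i, 0 <= a i) -> 0 <= b -> 0 <= c ->
  (\int[P]_omega (b * (\sum_(i in D) a i * `|X i omega| + c))%:E <=
   (b * (\sum_(i in D) a i + c))%:E)%E.
Proof.
move=> Xe a0 b0 c0.
have mX i : measurable_fun setT (fun omega => `|X i omega|%:E).
  apply/measurable_EFinP; apply: measurableT_comp => //; exact: measurable_funPT.
have mS i : measurable_fun setT (fun omega => (a i)%:E * `|X i omega|%:E)%E.
  exact: emeasurable_funM.
under eq_integral do rewrite EFinM EFinD -big_enum -sumEFin/=.
under eq_integral do under eq_bigr do rewrite EFinM.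
rewrite ge0_integralZl_EFin//; last 2 first.
- move=> omega _; rewrite adde_ge0// ?lee_fin// sume_ge0// => i _.
  by rewrite mule_ge0// lee_fin.
- by apply: emeasurable_funD => //; exact: emeasurable_sum.
rewrite [leRHS]EFinM; apply: lee_wpmul2l; first by rewrite lee_fin.
rewrite ge0_integralD//; last 2 first.
- by move=> omega _; rewrite sume_ge0// => i _; rewrite mule_ge0// lee_fin.
- exact: emeasurable_sum.
have -> : (\int[P]_(omega in setT) c%:E = c%:E)%E.
  by rewrite integral_cst//= probability_setT mule1.
rewrite EFinD leeD2r//.
rewrite ge0_integral_sum//; last first.
  by move=> i omega _; rewrite mule_ge0// lee_fin.
rewrite -big_enum -sumEFin big_seq [leRHS]big_seq lee_sum// => i.
rewrite mem_enum => iD; rewrite ge0_integralZl_EFin//.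
rewrite -[leRHS]mule1; apply: lee_wpmul2l; first by rewrite lee_fin.
exact: exp1_distributed_abs_mean (Xe i iD).
Qed.

(** * The number of iterations *)

Lemma harmonic_sum_le_ln (R : realType) (M : nat) : (0 < M)%N ->
  \sum_(k < M) (k.+1%:R)^-1 <= 1 + ln M%:R :> R.
Proof.
case: M => // M _; elim: M => [|M IH]; first by rewrite big_ord1 ln1 addr0 invr1.
rewrite big_ord_recr/=; apply: le_trans (lerD IH (lexx _)) _.
have q0 : 0 < M.+2%:R^-1 :> R by rewrite invr_gt0 ltr0n.
have M20 : (M.+2%:R : R) != 0 by rewrite pnatr_eq0.
(* With 1 - 1 / (M + 2) = (M + 1) / (M + 2), this bounds the new term by the increment of ln. *)
have : ln (1 + (- M.+2%:R^-1) : R) <= - M.+2%:R^-1.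
  by apply: le_ln1Dx; rewrite ltrN2 invf_lt1 ?ltr0n// ltr1n.
have -> : 1 + (- M.+2%:R^-1) = M.+1%:R / M.+2%:R :> R.
  by rewrite -[in RHS](addrK 1 M.+1%:R) -natr1 natr1 mulrBl divff// mul1r.
rewrite ln_div ?posrE ?ltr0n//.
move: (ln M.+1%:R) (ln M.+2%:R) (M.+2%:R^-1) => a b q h.
by rewrite -addrA lerD2l -lerBrDr -lerBlDl.
Qed.

Lemma ln_fact_le (R : realType) (n : nat) : ln ((n`!)%:R : R) <= n%:R * ln n%:R.
Proof.
elim: n => [|n IH]; first by rewrite fact0 ln1 mul0r.
rewrite factS natrM lnM ?posrE ?ltr0n ?fact_gt0//.
have -> : n.+1%:R * ln n.+1%:R = ln n.+1%:R + n%:R * ln n.+1%:R :> R.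
  by rewrite -natr1 mulrDl mul1r addrC.
rewrite lerD2l.
apply: le_trans IH _; case: n => [|n]; first by rewrite !mul0r.
by apply: ler_wpM2l => //; rewrite ler_ln ?posrE ?ltr0n// ler_nat.
Qed.

Lemma measure_bigsetU_le (R : realType) (disp : measure_display)
    (T : measurableType disp) (mu : {measure set T -> \bar R}) (I : finType)
    (D : {set I}) (A : I -> set T) :
  (forall i, i \in D -> measurable (A i)) ->
  measurable (\big[setU/set0]_(i in D) A i) /\
  (mu (\big[setU/set0]_(i in D) A i) <= \sum_(i in D) mu (A i))%E.
Proof.
move=> mA; apply: (big_ind2 (fun B x => measurable B /\ (mu B <= x)%E)).
- by rewrite measure0.
- move=> B x C y [mB Bx] [mC Cy]; split; first exact: measurableU.
  by apply: le_trans (measureU2 mu mB mC) _; exact: leeD.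
- by move=> i iD; split => //; exact: mA.
Qed.

Lemma expectation_le_tail_sum (R : realType) (disp : measure_display)
    (T : measurableType disp) (P : probability T R) (N : {RV P >-> nat})
    (M : nat) :
  (forall x, (N x <= M)%N) ->
  ('E_P[fun x => (N x)%:R] <= \sum_(k < M) P [set x | (k < N x)%N])%E.
Proof.
move=> NM; have mN k := measurable_nat_gt N k.
rewrite unlock.
have -> : (fun x => ((N x)%:R : R)%:E) =
    (fun x => \sum_(k < M) (\1_[set x | (k < N x)%N] x)%:E)%E.
  apply/funext => x; rewrite sumEFin; congr _%:E.
  under eq_bigr => k _ do rewrite indicE.
  have -> : (N x)%:R = \sum_(k < M | (k < N x)%N) 1 :> R.
    by rewrite -(big_ord_widen _ (fun _ => 1)) // sumr_const card_ord.
  rewrite big_mkcond; apply: eq_bigr => k _.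
  by case: ifPn => h; [rewrite mem_set|rewrite memNset//; exact/negP].
rewrite ge0_integral_sum//; last by move=> k; apply/measurable_EFinP.
by apply: lee_sum => k _; rewrite integral_indic// setIT.
Qed.

Lemma two_opt_run_trivial (R : realType) (V : finType) (d : V -> V -> R)
    (t : seq V) (N : nat) :
  (#|V| <= 1)%N -> is_tour t -> two_opt_run d t N -> N = 0%N.
Proof.
move=> V1 tt run; case: run tt => // {t N} s t' N [[k [A [B [A0 B0 sE _]]]] _] _.
move=> /perm_size; rewrite -cardE -(size_rot k) sE size_cat => sz.
move: V1; rewrite -sz; case: A A0 {sE sz} => // a A _; case: B B0 => // b B _.
by rewrite /= addnS.
Qed.

(** Every distance is at most that of the detour through the root r along fixed geodesics. The
    coefficients depend on the graph alone; 12 is 2 from [tour_length_le] times 6 from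
    [geodesic_size_le]. *)
Lemma tour_length_linear_bound (R : realType) (V : finType) (e : rel V) :
  simple_connected e -> (1 < #|V|)%N ->
  exists2 c : {set V} -> nat,
    forall (w : {set V} -> R) t, (forall f, f \in edges e -> 0 <= w f) ->
      is_tour t ->
      tour_length (sp_dist e w) t <= \sum_(f in edges e) (c f)%:R * w f &
    (\sum_(f in edges e) c f)%:R <= 12 * #|V|%:R / cut_alpha R e.
Proof.
move=> sc V1; have [eC _ econ] := sc.
have /card_gt0P[r _] := ltnW V1.
have /choice[p pP] : forall v, exists p, geodesic e r p /\ last r p = v.
  by move=> v; have [p ? ?] := geodesic_exists (econ r v); exists p.
exists (fun f => \sum_v 2 * count_mem f (path_edges r (p v)))%N.
  move=> w t w0 tt.
  apply: le_trans (tour_length_le (h := fun v => path_weight w r (p v)) _ tt) _.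
    move=> x y; have [[px _] lx] := pP x; have [[py _] ly] := pP y.
    pose q := rev (belast r (p x)) ++ p y.
    have xq : path e x q.
      rewrite cat_path -{1}lx rev_path -[X in last X _]lx last_rev_belast py andbT.
      by rewrite (eq_path (e' := e)).
    have lq : last x q = y by rewrite last_cat -[X in last X (rev _)]lx last_rev_belast.
    rewrite -{1}lq; apply: le_trans (sp_dist_le_walk w0 xq) _.
    rewrite !path_weightE walk_sum_cat -[X in walk_sum _ X (rev _)]lx.
    rewrite -[X in last X (rev _)]lx last_rev_belast walk_sum_rev//.
    by move=> y' z; rewrite finset.setUC.
  under [leRHS]eq_bigr do rewrite natr_sum mulr_suml.
  rewrite exchange_big/= ler_sum// => v _; have [[pv _] _] := pP v.
  rewrite /path_weight (big_seq_count _ (path_edges_sub pv)) mulr_sumr.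
  by rewrite ler_sum// => f _; rewrite natrM mulrA.
rewrite exchange_big/= natr_sum.
apply: (@le_trans _ _ (\sum_(v : V) 12 / cut_alpha R e)); last first.
  by rewrite sumr_const -[leLHS]mulr_natl mulrCA mulrA.
apply: ler_sum => v _; have [geo _] := pP v.
rewrite -big_distrr/= natrM.
have -> : (\sum_(f in edges e) count_mem f (path_edges r (p v)))%:R =
    (size (p v))%:R :> R.
  have := big_seq_count (R := R) (fun=> 1) (path_edges_sub geo.1).
  rewrite big_const_seq count_predT iter_addr_0 size_path_edges => ->.
  by rewrite natr_sum; apply: eq_bigr => f _; rewrite mulr1.
have := geodesic_size_le R sc V1 geo; lra.
Qed.

(** Otherwise every positive gain would exceed L / (k + 1), and the N >= k + 1 iterations would
    shorten the tour by more than L. *)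
Lemma two_opt_run_witness (R : realType) (V : finType) (e : rel V)
    (w : {set V} -> R) (t : seq V) (N k : nat) (L : R) :
  simple_connected e -> (forall f, f \in edges e -> 0 <= w f) ->
  is_tour t -> tour_length (sp_dist e w) t <= L ->
  two_opt_run (sp_dist e w) t N -> (k < N)%N ->
  exists v f b, [/\ f \in edges e, slope R b != 0,
    0 < residual_gain e w f b v + slope R b * w f &
    k.+1%:R * (residual_gain e w f b v + slope R b * w f) <= L].
Proof.
move=> [eC eI econ] w0 tt tL run kN; apply: contrapT => nex.
have k0 : 0 < k.+1%:R :> R by rewrite ltr0n.
have d0 x y : 0 <= sp_dist e w x y by exact: sp_dist_ge0.
have L0 : 0 <= L by apply: le_trans tL; rewrite /tour_length sumr_ge0.
have dgain v : 0 < gain (sp_dist e w) v -> L / k.+1%:R < gain (sp_dist e w) v.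
  move=> v0; rewrite ltNge; apply/negP => vL; apply: nex.
  have [f [b [fE b0 vE]]] := gain_residual econ (lt0r_neq0 v0).
  exists v, f, b; split => //; first by rewrite -vE.
  by rewrite -vE mulrC -ler_pdivlMr.
have := two_opt_run_lt (fun x y => sp_distC w x y eC) d0 dgain tt run
  (leq_ltn_trans (leq0n k) kN).
apply/negP; rewrite -leNgt; apply: (le_trans tL).
by rewrite mulrCA ler_peMr// ler_pdivlMr// mul1r ler_nat.
Qed.

Lemma iterations_tail_le (R : realType) (V : finType) (e : rel V)
    (disp : measure_display) (Omega : measurableType disp)
    (P : probability Omega R) (w : {set V} -> {RV P >-> R})
    (init : Omega -> seq V) (iterations : {RV P >-> nat})
    (c : {set V} -> nat) (k : nat) :
  simple_connected e -> mutually_independent (edges e) w ->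
  (forall f : {set V}, f \in edges e -> exp1_distributed (w f)) ->
  (forall omega : Omega, is_tour (init omega)) ->
  (forall omega : Omega,
     two_opt_run (sp_dist e (fun f => w f omega))
       (init omega) (iterations omega)) ->
  (forall (w : {set V} -> R) t, (forall f, f \in edges e -> 0 <= w f) ->
      is_tour t ->
      tour_length (sp_dist e w) t <= \sum_(f in edges e) (c f)%:R * w f) ->
  (P [set omega | (k < iterations omega)%N] <=
   ((#|V| ^ 4 * #|edges e| * 16)%:R *
    (2 * (\sum_(f in edges e) c f)%:R / k.+1%:R))%:E)%E.
Proof.
move=> sc indep we tt run cP.
(* The part of S that is free of [w f]; absolute values make it nonnegative everywhere. *)
pose s f omega := \sum_(g <- enum (edges e :\ f)%SET) (c g)%:R * `|w g omega| : R.
pose A (i : V * V * V * V * {set V} * (bool * bool * bool * bool)) :=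
  let: (v, f, b) := i in
  let C omega := residual_gain e (fun g => w g omega) f b v in
  if slope R b != 0 then
  [set omega | [/\ 0 <= w f omega, 0 < C omega + slope R b * w f omega &
      k.+1%:R * (C omega + slope R b * w f omega) <=
      s f omega + (c f)%:R * w f omega]] else set0.
pose D := finset.setX (finset.setX [set: V * V * V * V]%SET (edges e))
  [set: bool * bool * bool * bool]%SET.
pose neg f := [set omega | w f omega < 0].
have mw f : measurable_fun setT (w f : Omega -> R) by exact: measurable_funPT.
have ms f : measurable_fun setT (s f).
  apply: measurable_sum_seq => g _; apply: measurable_funM => //.
  by apply: measurableT_comp => //; exact: mw.
have mneg f : measurable (neg f) by exact: (measurable_set_lt (mw f)).
have mA i : i \in D -> measurable (A i).
  case: i => [[v f] b] _; rewrite /A; case: ifP => // b0.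
  have mC : measurable_fun setT
      (fun omega => residual_gain e (fun g => w g omega) f b v).
    exact: (measurable_residual_gain (w := fun g => w g : Omega -> R)).
  have mC' : measurable_fun setT (fun omega =>
      residual_gain e (fun g => w g omega) f b v + slope R b * w f omega).
    by apply: measurable_funD => //; exact: measurable_funM.
  rewrite (_ : [set _ | _] = [set omega | 0 <= w f omega] `&`
    [set omega | 0 < residual_gain e (fun g => w g omega) f b v + slope R b * w f omega] `&`
    [set omega | k.+1%:R * (residual_gain e (fun g => w g omega) f b v + slope R b * w f omega)
       <= s f omega + (c f)%:R * w f omega]); last first.
    by apply/seteqP; split => omega /=; [case|case=> -[]].
  apply: measurableI; first apply: measurableI.
  - exact: (measurable_set_le (f := cst 0)).
  - exact: (measurable_set_lt (f := cst 0)).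
  - apply: measurable_set_le; first exact: measurable_funM.
    by apply: measurable_funD => //; exact: measurable_funM.
have [mUA PUA] := measure_bigsetU_le P mA.
have [mUn PUn] := measure_bigsetU_le P (D := edges e) (fun f _ => mneg f).
(* Up to a negative weight, a long run falls into one of the strip events, indexed by exchange, edge
   and membership pattern. *)
have msub : [set omega | (k < iterations omega)%N] `<=`
    (\big[setU/set0]_(f in edges e) neg f) `|` (\big[setU/set0]_(i in D) A i).
  move=> omega /= kN; rewrite -!bigcup_seq_cond/=.
  have [[f fE f0]|nneg] := pselect (exists2 f, f \in edges e & w f omega < 0).
    by left; exists f => //=; rewrite mem_index_enum.
  have w0 f : f \in edges e -> 0 <= w f omega.
    by move=> fE; rewrite leNgt; apply/negP => f0; apply: nneg; exists f.
  have [v [f [b [fE b0 g0 gL]]]] := two_opt_run_witness sc w0 (tt omega)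
    (cP _ _ w0 (tt omega)) (run omega) kN.
  right; exists (v, f, b); first by rewrite /= mem_index_enum !inE fE.
  rewrite /A b0 /=; split => //; first exact: w0.
  apply: le_trans gL _; rewrite (big_setD1 f)//= addrC lerD2r /s big_enum.
  apply: ler_sum => g; rewrite !inE => /andP[_ gE].
  by apply: ler_wpM2l => //; exact: ler_norm.
apply: (@le_trans _ _ (P ((\big[setU/set0]_(f in edges e) neg f) `|`
    (\big[setU/set0]_(i in D) A i)))).
  apply: le_measure; rewrite ?inE//; last exact: measurableU.
  exact: measurable_nat_gt.
apply: le_trans (measureU2 P mUn mUA) _.
apply: le_trans (leeD PUn PUA) _; rewrite big1 ?add0e => [|f fE]; last first.
  exact: (exp1_distributed_lt0 (we f fE)).
apply: (@le_trans _ _ (\sum_(i in D) (2 * (\sum_(f in edges e) c f)%:R / k.+1%:R)%:E)%E);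
    last first.
  have cD : #|D| = (#|V| ^ 4 * #|edges e| * 16)%N.
    rewrite !cardsX !cardsT !card_prod card_bool !expnS expn0 muln1 !mulnA.
    by rewrite -!mulnA.
  by rewrite sumEFin lee_fin sumr_const cD -[leLHS]mulr_natl.
apply: lee_sum => -[[v f] b]; rewrite !inE/= andbT => fE; rewrite /A.
have K0 : 0 <= 2 * (\sum_(f in edges e) c f)%:R / k.+1%:R :> R by rewrite !mulr_ge0.
case: ifP => [b0|_]; last by rewrite measure0 lee_fin.
apply: le_trans (independent_strip_le
  (C := fun omega => residual_gain e (fun g => w g omega) f b v)
  (s := s f) (c := (c f)%:R) (k := k.+1%:R) indep fE (we f fE) _ _ (ms f) _ _ _
  (slope_norm_ge1 b0)) _ => //.
- apply: (measurable_residual_gain (w := fun g => w g : g_sigma_algebraType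
    (cylinders (fun j => w j : Omega -> R) (edges e :\ f)%SET) -> R)).
  by move=> g gE gf; apply: cylinders_measurable_fun; rewrite !inE gf.
- apply: measurable_sum_seq => g; rewrite mem_enum => gD.
  apply: measurable_funM => //; apply: measurableT_comp => //.
  exact: cylinders_measurable_fun.
- by move=> omega; rewrite /s sumr_ge0.
rewrite (_ : (fun omega => _) = (fun omega =>
  ((2 / k.+1%:R) * (\sum_(g in (edges e :\ f)%SET) (c g)%:R * `|w g omega| + (c f)%:R))%:E));
  last by apply/funext => omega; rewrite /s big_enum mulrAC.
apply: le_trans (integral_affine_le _ _ _ _) _ => //.
  by move=> g; rewrite !inE => /andP[_ /we].
by rewrite lee_fin natr_sum (big_setD1 f fE)/= [leRHS]mulrAC [(c f)%:R + _]addrC.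
Qed.

Lemma ln_ge_half (R : realType) (n : nat) : (1 < n)%N -> 1 / 2 <= ln n%:R :> R.
Proof.
move=> n1; apply: (@le_trans _ _ (ln 2)); last first.
  by rewrite ler_ln ?posrE ?ltr0n ?ler_nat// (ltn_trans _ n1).
have := @le_ln1Dx R (- (1 / 2)); have -> : 1 + - (1 / 2) = 2^-1 :> R by lra.
by rewrite lnV ?posrE//; lra.
Qed.

(** As n ln n >= 1 and (ln n)^2 >= 1 / 4, H is at most 2 n ln n <= 8 n (ln n)^3. The constant is
    3072 = 16 * 2 * 12 * 8. *)
Lemma numeric_bound (R : realType) (n E T : nat) (alpha beta H : R) :
  (1 < n)%N -> 0 < alpha -> 0 <= beta -> 0 <= H ->
  E%:R <= beta * n%:R ^+ 2 -> T%:R <= 12 * n%:R / alpha ->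
  H <= 1 + n%:R * ln n%:R ->
  (n ^ 4 * E * 16)%:R * (2 * T%:R * H) <=
  3072%:R * (n%:R ^+ 8 * ln n%:R ^+ 3 * (beta / alpha)).
Proof.
move=> n1 a0 b0 H0 hE hT hH.
have l2 := ln_ge_half R n1; set l := ln n%:R in l2 hH *.
have n2 : 2 <= n%:R :> R by rewrite ler_nat.
have l3 : 1 / 4 * l <= l ^+ 3.
  have -> : l ^+ 3 = l ^+ 2 * l by rewrite -exprSr.
  rewrite ler_pM2r; last lra.
  have -> : 1 / 4 = (1 / 2) ^+ 2 :> R by field.
  by rewrite ler_sqr ?nnegrE//; lra.
have nl : 1 <= n%:R * l.
  have : 0 <= (n%:R - 2) * l by apply: mulr_ge0; lra.
  lra.
have hH' : H <= 8 * (n%:R * l ^+ 3).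
  have : 1 / 4 * (n%:R * l) <= n%:R * l ^+ 3 by rewrite mulrCA ler_wpM2l.
  by move: (n%:R * l) (n%:R * l ^+ 3) hH nl => x y; lra.
rewrite natrM natrM natrX.
have -> : 3072%:R * (n%:R ^+ 8 * l ^+ 3 * (beta / alpha)) =
    n%:R ^+ 4 * (beta * n%:R ^+ 2) * 16 *
    (2 * (12 * n%:R / alpha) * (8 * (n%:R * l ^+ 3))).
  by field; rewrite gt_eqF.
apply: ler_pM => //.
- by rewrite !mulr_ge0// exprn_ge0.
- by rewrite ler_wpM2r// ler_wpM2l// exprn_ge0.
by apply: ler_pM => //; rewrite ler_wpM2l.
Qed.

Theorem theorem6 :
  exists C : nat,
  forall (R : realType) (V : finType) (e : rel V)
    (disp : measure_display) (Omega : measurableType disp)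
    (P : probability Omega R) (w : {set V} -> {RV P >-> R})
    (init : Omega -> seq V) (iterations : {RV P >-> nat}),
  simple_connected e ->
  mutually_independent (edges e) w ->
  (forall f : {set V}, f \in edges e -> exp1_distributed (w f)) ->
  (forall omega : Omega, is_tour (init omega)) ->
  (forall omega : Omega,
     two_opt_run (sp_dist e (fun f => w f omega))
       (init omega) (iterations omega)) ->
  ('E_P[fun omega => (iterations omega)%:R] <=
   (C%:R * (#|V|%:R ^+ 8 * ln (#|V|%:R) ^+ 3 *
     (cut_beta R e / cut_alpha R e)))%:E)%E.
Proof.
exists 3072%N => R V e disp Omega P w init iterations sc indep we tt run.
(* With at most one vertex there is no exchange, and the bound is 0 because [ln] vanishes at 0 and
   at 1. *)
have [V1|V1] := leqP #|V| 1.
  have it0 omega : iterations omega = 0%N.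
    exact: two_opt_run_trivial V1 (tt omega) (run omega).
  have -> : (fun omega => (iterations omega)%:R : R) = cst 0.
    by apply/funext => omega; rewrite it0.
  rewrite expectation_cst lee_fin.
  have -> : ln #|V|%:R = 0 :> R.
    by case: #|V| V1 => [_|[|//] _]; [rewrite ln0|rewrite ln1].
  by rewrite expr0n/= mulr0 mul0r mulr0.
have [c cP cS] := tour_length_linear_bound R sc V1.
have itM omega := two_opt_run_card (tt omega) (run omega).
apply: le_trans (expectation_le_tail_sum itM) _.
have tail k := iterations_tail_le k sc indep we tt run cP.
apply: le_trans (lee_sum _ (fun (k : 'I_((#|V|)`!)) _ => tail k)) _.
rewrite sumEFin lee_fin -mulr_sumr -mulr_sumr.
apply: numeric_bound => //.
- exact: cut_alpha_gt0.
- exact: cut_beta_ge0.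
- by rewrite sumr_ge0.
- apply: le_trans (card_edges_le R sc V1) _; apply: ler_wpM2l.
    exact: cut_beta_ge0.
  by rewrite expr2 ler_wpM2l// ler_nat leq_pred.
- apply: le_trans (harmonic_sum_le_ln R (fact_gt0 _)) _.
  by rewrite lerD2l ln_fact_le.
Qed.
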